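(* For any integer $n\ge 1$ and any integer $0\le r\le n-1$, $$\mathbb E M_{n,r}\le \inf_{0<\varepsilon\le1/2}\left\{\varphi^{+}_{n,r}(\varepsilon)+\theta^{+}_{n,r}(\varepsilon)\right\},$$ where $$\varphi^{+}_{n,r}(\varepsilon)=\frac{c(r)\,\nu(\varepsilon)}{n},\qquad \theta^{+}_{n,r}(\varepsilon)=2^{1+r}\binom{n}{r}\int_{0}^{\varepsilon}(\kappa_+(2u)-1)\,\nu(u)\,u^r\left(1-\frac u2\right)^{n-r}\mathrm du .$$
   Context: $\mathcal A$ is an at most countable set and $P=\{p_a:a\in\mathcal A\}$ is a probability distribution on $\mathcal A$ ($p_a\in[0,1]$, $\sum_{a}p_a=1$). $X_1,\dots,X_n$ are i.i.d. $\mathcal A$-valued random variables with distribution $P$; $\xi_n(a)=\sum_{i=1}^n\mathbf 1\{X_i=a\}$. For $0\le r\le n$, $M_{n,r}=\sum_{a\in\mathcal A}p_a\mathbf 1\{\xi_n(a)=r\}$. The counting function of $P$ is $\nu(\varepsilon)=|\{a\in\mathcal A:p_a\ge\varepsilon\}|$ for $0\le\varepsilon\le 1$. The constant $c(r)$ is $c(0)=e^{-1}$ and $c(r)=e(1+r)/\sqrt{\pi}$ for $r\ge 1$. For $\varepsilon\in(0,1]$, $\kappa_+(\varepsilon)=\sup_{0<u\le\varepsilon}\nu(u/2)/\nu(u)\in[1,+\infty]$, where a ratio with denominator $\nu(u)=0$ is interpreted as $+\infty$; in the integrand of $\theta^+_{n,r}$, the product $\infty\cdot 0$ is interpreted as $0$.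 *)

(* Defs.v *)
From HB Require Import structures.
From mathcomp Require Import all_boot all_order all_algebra.
From mathcomp Require Import all_classical all_reals all_analysis.
Import Order.TTheory GRing.Theory Num.Theory.
Import numFieldNormedType.Exports.

Set Implicit Arguments.
Unset Strict Implicit.
Unset Printing Implicit Defensive.

Local Open Scope classical_set_scope.
Local Open Scope ring_scope.
Local Open Scope ereal_scope.

Section probability_distribution.
Context {R : realType} {A : choiceType}.
Implicit Types (p : A -> R) (u eps : R).

Definition is_pmf p : Prop :=
  (forall a, (0 <= p a <= 1)%R) /\ \esum_(a in [set: A]) (p a)%:E = 1.

Definition nu p eps : \bar R := counting [set a | (eps <= p a)%R].

(* For 0 < u the value nu p u is finite, so that the extended-real quotient is
   the quotient of two finite numbers. *)
Definition nu_ratio p u : \bar R :=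
  if nu p u == 0 then +oo else nu p (u / 2)%R / nu p u.

Definition kappa_plus p eps : \bar R :=
  ereal_sup [set nu_ratio p u | u in `]0%R, eps]].

Definition c_const (r : nat) : R :=
  if r == 0%N then expR (-1) else (expR 1 * (1 + r%:R) / Num.sqrt pi)%R.

Definition phi_plus p (n r : nat) eps : \bar R :=
  (c_const r)%:E * nu p eps / n%:R%:E.

(* The product of extended reals satisfies +oo * 0 = 0.  The integration domain
   excludes 0 (a null set), where kappa_plus is not meaningful. *)
Definition theta_plus p (n r : nat) eps : \bar R :=
  ((2 ^+ (1 + r) * 'C(n, r)%:R)%R)%:E *
  \int[lebesgue_measure]_(u in `]0%R, eps])
    ((kappa_plus p (2 * u)%R - 1) * nu p u
     * ((u ^+ r * (1 - u / 2) ^+ (n - r))%R)%:E).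

End probability_distribution.

Section sample.
Context {d dA : measure_display} {Omega : measurableType d}
  {A : measurableType dA} {R : realType} {Pr : probability Omega R}.

Definition mutually_independent (n : nat) (X : 'I_n -> {RV Pr >-> A}) : Prop :=
  forall (J : {set 'I_n}) (B : 'I_n -> set A),
    (forall i, measurable (B i)) ->
    Pr (\bigcap_(i in [set` J]) (X i @^-1` B i)) =
    \prod_(i in J) Pr (X i @^-1` B i).

Definition iid_sample (p : A -> R) (n : nat) (X : 'I_n -> {RV Pr >-> A}) :
    Prop :=
  mutually_independent X /\
  forall i a, distribution Pr (X i) [set a] = (p a)%:E.

Definition xi (n : nat) (X : 'I_n -> {RV Pr >-> A}) (a : A) (w : Omega) : nat :=
  (\sum_(i < n) (X i w == a))%N.

(* The series has sum at most 1 when p is a probability mass function, so that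
   fine is only a change of type. *)
Definition M (p : A -> R) (n r : nat) (X : 'I_n -> {RV Pr >-> A}) (w : Omega) :
    R :=
  fine (\esum_(a in [set: A]) (p a * (xi X a w == r)%:R)%:E).

End sample.

(* Main.v *)
Require Import Defs.
From HB Require Import structures.
From mathcomp Require Import all_boot all_order all_algebra.
From mathcomp Require Import finmap.
From mathcomp Require Import all_classical all_reals all_analysis.
From mathcomp Require Import measurable_realfun.
From mathcomp Require Import ring lra.
Import Order.TTheory GRing.Theory Num.Theory.
Import numFieldNormedType.Exports.

(** The number of occurrences of a letter a is binomial, so that
    E M_(n,r) = sum_a p_a g(p_a) with g(x) = C(n,r) x^r (1-x)^(n-r), by
    Tonelli ([xi_binomial], [expected_M_le]). The sum is cut at the level eps.

    Letters with p_a >= eps: there are nu(eps) of them, and each contributes at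
    most c(r)/n ([expected_mass_le_c]). For r >= 1 this is because
    (n+1) x g(x) is (r+1) times a binomial probability with parameter n+1, hence
    at most r+1; for r = 0 it is y e^-y <= e^-1 at y = nx.

    Letters with p_a < eps: evaluating the supremum that defines kappa_+(2u) at its
    right end point 2u gives
      (kappa_+(2u) - 1) nu(u) >= nu(u) - nu(2u) = #{a : u <= p_a < 2u}
    ([counting_dyadic_le_kappa]). Conversely p_a/2 < u <= p_a puts a in that
    set, and on this window of length p_a/2 the weight u^r (1-u/2)^(n-r) is at
    least (p_a/2)^r (1-p_a)^(n-r). Summing over the small letters under the
    integral sign therefore bounds the integral of theta from below by
    sum_a (p_a/2)^(r+1) (1-p_a)^(n-r), and the prefactor 2^(1+r) C(n,r) turns
    this into sum_a p_a g(p_a) ([small_atoms_le_theta]). *)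

Set Implicit Arguments.
Unset Strict Implicit.

Local Open Scope classical_set_scope.
Local Open Scope ring_scope.
Local Open Scope ereal_scope.

(** * Bounds on a single letter *)

Lemma binomial_pmf_le1 (R : realType) (n r : nat) (x : R) :
  (r <= n)%N -> (0 <= x <= 1)%R ->
  ('C(n, r)%:R * (x ^+ r * (1 - x) ^+ (n - r)) <= 1)%R.
Proof.
move=> rn /andP[x0 x1].
have y0 : (0 <= 1 - x)%R by rewrite subr_ge0.
have e1 : (1 = (1 - x + x) ^+ n :> R)%R by rewrite subrK expr1n.
rewrite [X in (_ <= X)%R]e1 (exprDn (1 - x)%R x).
rewrite (bigD1 (inord r)) //= inordK ?ltnS//.
rewrite -[X in (X <= _)%R]addr0 lerD//.
  by rewrite mulr_natl [(x ^+ r * _)%R]mulrC.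
by apply: sumr_ge0 => i _; rewrite mulrn_wge0// mulr_ge0// exprn_ge0.
Qed.

(** For r = 0 the maximum of y e^-y is attained at y = 1. For r >= 1 the bound
    1 + r suffices, since e / sqrt pi >= 1 by pi < 4 and 2 <= e. *)
Lemma expected_mass_le_c (R : realType) (n r : nat) (x : R) :
  (1 <= n)%N -> (r <= n - 1)%N -> (0 <= x <= 1)%R ->
  (x * ('C(n, r)%:R * (x ^+ r * (1 - x) ^+ (n - r))) <= c_const r / n%:R)%R.
Proof.
move=> n1 rn x01; have /andP[x0 x1] := x01.
have n0 : (0 < n%:R :> R)%R by rewrite ltr0n.
rewrite ler_pdivlMr// /c_const; case: eqP => [->|/eqP r0].
  rewrite bin0 !mul1r subn0.
  have h1 : ((1 - x) ^+ n <= expR (- (n%:R * x)))%R.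
    rewrite -mulrN expRM_natl lerXn2r ?nnegrE ?expR_ge0 ?subr_ge0//.
    exact: expR_ge1Dx.
  have h2 : (n%:R * x <= expR (n%:R * x - 1))%R.
    by have := expR_ge1Dx (n%:R * x - 1 : R)%R; rewrite addrC subrK.
  rewrite mulrAC [X in (X * _)%R]mulrC.
  apply: (@le_trans _ _ (expR (n%:R * x - 1) * expR (- (n%:R * x))))%R.
    by apply: ler_pM => //; rewrite ?mulr_ge0 ?exprn_ge0 ?subr_ge0 ?ler0n.
  by rewrite -expRD addrAC subrr sub0r.
have rn' : (r <= n)%N by rewrite (leq_trans rn) ?leq_subr.
(* (n+1) C(n,r) = (r+1) C(n+1,r+1) absorbs the factor x into a binomial
   probability of one more trial. *)
have h : (n.+1%:R * (x * ('C(n, r)%:R * (x ^+ r * (1 - x) ^+ (n - r)))) <=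
    1 + r%:R :> R)%R.
  rewrite [X in (X <= _)%R](_ : _ = r.+1%:R *
    ('C(n.+1, r.+1)%:R * (x ^+ r.+1 * (1 - x) ^+ (n.+1 - r.+1))))%R; last first.
    rewrite [RHS]mulrA -natrM -mul_bin_diag natrM subSS exprS /=; ring.
  rewrite [X in (_ <= X)%R]addrC natr1 -[X in (_ <= X)%R]mulr1 ler_wpM2l ?ler0n//.
  exact: binomial_pmf_le1.
apply: (@le_trans _ _ (1 + r%:R)%R).
  apply: le_trans h; rewrite mulrC ler_wpM2r ?ler_nat//.
  by rewrite !(mulr_ge0, exprn_ge0) ?subr_ge0 ?ler0n.
rewrite mulrAC ler_peMl ?addr_ge0 ?ler0n//.
have pi4 : (@pi R < 4)%R by have := @pihalf_lt2 R; lra.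
have e2 : (2 <= expR 1 :> R)%R by have := expR_ge1Dx (1 : R); lra.
have s0 : (0 < Num.sqrt (@pi R))%R by rewrite sqrtr_gt0 pi_gt0.
rewrite ler_pdivlMr// mul1r (le_trans _ e2)//.
rewrite -(@ler_pXn2r _ 2)// ?nnegrE ?sqrtr_ge0// sqr_sqrtr ?pi_ge0//.
by rewrite ltW// (lt_le_trans pi4)// -natrX ler_nat.
Qed.

(** * Integrals and unordered sums *)

Section integral_monotone.
Import HBNNSimple.

(** The integral of a nonnegative function is a supremum over the simple
    functions below it, so monotonicity holds for nonmeasurable functions.
    This spares the measurability of kappa_+, a supremum of uncountably many
    ratios. *)
Lemma ge0_le_integral_nonmeasurable d (T : measurableType d) (R : realType)
    (mu : {measure set T -> \bar R}) (D : set T) (f g : T -> \bar R) :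
  (forall x, D x -> 0 <= f x) -> (forall x, D x -> f x <= g x) ->
  \int[mu]_(x in D) f x <= \int[mu]_(x in D) g x.
Proof.
move=> f0 fg.
have g0 x : D x -> 0 <= g x by move=> Dx; exact: le_trans (f0 _ Dx) (fg _ Dx).
rewrite !ge0_integralE//; apply: ereal_sup_le => _ /= [h hf <-].
exists h => // x.
by apply: (le_trans (hf x)); exact: lee_restrict.
Qed.

End integral_monotone.

(** Tonelli for an unordered countable sum, obtained from the theorem on series
    by an injection of the index set into nat, with zero terms outside of its
    image. *)
Lemma integral_esum d (T : measurableType d) (R : realType)
    (mu : {measure set T -> \bar R}) (D : set T) (mD : measurable D)
    (I : choiceType) (S : set I) (f : I -> T -> \bar R) :
  countable S ->
  (forall i, S i -> measurable_fun D (f i)) ->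
  (forall i x, S i -> D x -> 0 <= f i x) ->
  \int[mu]_(x in D) (\esum_(i in S) f i x) =
  \esum_(i in S) \int[mu]_(x in D) f i x.
Proof.
move=> cS mf f0; have [->|/set0P[i0 Si0]] := eqVneq S set0.
  rewrite esum_set0; under eq_integral do rewrite esum_set0.
  by rewrite integral0.
have /countable_injP[e injS] := cS.
pose h := 'pinv_(fun=> i0) S e; pose Q := e @` S.
have bh : set_bij Q S h := injpinv_bij (fun=> i0) injS.
have hS k : k \in Q -> S (h k) by move=> /set_mem; case: bh => + _ _; exact.
have esumE (F : I -> \bar R) : (forall i, S i -> 0 <= F i) ->
    \esum_(i in S) F i = \sum_(k <oo) if k \in Q then F (h k) else 0.
  move=> F0; rewrite (reindex_esum _ _ _ _ bh) esum_mkcond nneseries_esumT// => k.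
  by case: ifPn => // /hS; exact: F0.
rewrite esumE; last by move=> i Si; apply: integral_ge0 => x; exact: f0.
under eq_integral => x /set_mem Dx.
  rewrite esumE; last by move=> i Si; exact: f0.
  over.
pose g k x := if k \in Q then f (h k) x else 0.
rewrite (@integral_nneseries _ _ _ mu D mD g); last 2 first.
- by move=> k; rewrite /g; have [/hS|_] := boolP (k \in Q); [exact: mf|exact: measurable_cst].
- by move=> k x Dx; rewrite /g; case: ifPn => [/hS|//] Sk; exact: f0.
apply: eq_eseriesr => k _; rewrite /g; case: ifPn => // _; exact: integral0.
Qed.

Lemma esumZ_le (R : realType) (I : choiceType) (S : set I) (c : R)
    (f : I -> \bar R) :
  (0 <= c)%R -> (forall i, 0 <= f i) ->
  \esum_(i in S) (c%:E * f i) <= c%:E * \esum_(i in S) f i.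
Proof.
move=> c0 f0; apply: ge_ereal_sup => _ [X XS <-].
rewrite -ge0_mule_fsumr// lee_wpmul2l ?lee_fin//.
by apply: ereal_sup_ubound; exists X.
Qed.

Lemma esum_cst_counting (R : realType) (I : choiceType) (S : set I) (c : R) :
  finite_set S -> (0 <= c)%R -> \esum_(i in S) c%:E = c%:E * counting S.
Proof.
move=> finS c0; rewrite esum_fset// fsbig_finite//= sumEFin.
rewrite /counting asboolT// -EFinM; congr _%:E.
by rewrite big_const_seq iter_addr_0 mulr_natr count_predT.
Qed.

(** * The counting function and kappa *)

(** More than 1/u letters of probability at least u would have total mass
    greater than 1. *)
Lemma finite_atoms_ge (R : realType) (A : choiceType) (p : A -> R) (u : R) :
  is_pmf p -> (0 < u)%R -> finite_set [set a | (u <= p a)%R].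
Proof.
move=> [p01 p1] u0; apply: contrapT => infS.
have [B BS nB] := infinite_set_fset (Num.bound u^-1) infS.
have : \sum_(a \in [set` B]) (p a)%:E <= 1.
  by rewrite -p1; apply: ereal_sup_ubound; exists [set` B].
rewrite fsbig_finite//= set_fsetK sumEFin lee_fin leNgt => /negP; apply.
have /archi_boundP : (0 <= u^-1)%R by rewrite invr_ge0 ltW.
rewrite -(ltr_pM2r u0) mulVf ?gt_eqF// => /lt_le_trans; apply.
apply: (@le_trans _ _ (#|` B|%:R * u)%R); first by rewrite ler_pM2r ?ler_nat.
rewrite mulr_natl -(@count_predT _ B) -iter_addr_0 -big_const_seq.
rewrite [X in (X <= _)%R]big_seq_cond [X in (_ <= X)%R]big_seq_cond.
by apply: ler_sum => a /andP[/BS].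
Qed.

(** The supremum at the point 2u gives kappa_+(2u) >= nu(u)/nu(2u), and
    (nu(u)/nu(2u) - 1) nu(u) >= nu(u) - nu(2u) because nu(u) >= nu(2u). When
    nu(2u) = 0 < nu(u) the right-hand side is infinite, and when nu(u) = 0 both
    sides vanish by the convention that infinity times 0 is 0. *)
Lemma counting_dyadic_le_kappa (R : realType) (A : choiceType) (p : A -> R)
    (u : R) : is_pmf p -> (0 < u)%R ->
  counting [set a | (u <= p a < 2 * u)%R] <=
  (kappa_plus p (2 * u) - 1) * nu p u.
Proof.
move=> pmf u0.
have u20 : (0 < 2 * u)%R by rewrite mulr_gt0.
have fin1 := finite_atoms_ge pmf u0; have fin2 := finite_atoms_ge pmf u20.
set B := [set a | _].
have finB : finite_set B by apply: sub_finite_set fin1 => a /= /andP[].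
have nuD : nu p u = nu p (2 * u) + counting B.
  have cnt1 (S : set A) : finite_set S ->
      counting S = \esum_(a in S) 1%:E :> \bar R.
    by move=> fS; rewrite esum_cst_counting// mul1e.
  rewrite /nu !cnt1// (esumID [set a | (2 * u <= p a)%R])//.
  congr (_ + _); congr (esum _ _); apply/seteqP; rewrite ?/B; split => a /=.
  - by case.
  - by move=> h; split => //; apply: le_trans h; rewrite ler_peMl ?ler1n// ltW.
  - by move=> [-> /negP]; rewrite -ltNge => ->.
  - by move=> /andP[-> h]; split => //; apply/negP; rewrite -ltNge.
(* Below, m is nu(2u) and b the number of letters with u <= p < 2u. *)
have : nu_ratio p (2 * u) <= kappa_plus p (2 * u).
  by apply: ereal_sup_ubound; exists (2 * u)%R => //=; rewrite in_itv/= u20 lexx.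
rewrite /nu_ratio nuD (_ : 2 * u / 2 = u)%R; last by field.
rewrite nuD; move: (kappa_plus p (2 * u)) => k.
rewrite /nu /counting !asboolT// -!EFinD -natrD.
move: #|` _| #|` _| => b m.
rewrite eqe pnatr_eq0; case: (posnP m) => [->|m0].
  rewrite add0n /= leye_eq => /eqP ->.
  case: (posnP b) => [->|b0]; first by rewrite mule0.
  by rewrite mulyr gtr0_sg ?ltr0n// mul1e leey.
rewrite inver pnatr_eq0 gtn_eqF// -EFinM => hk.
have m0' : (0 < m%:R :> R)%R by rewrite ltr0n.
apply: (@le_trans _ _ ((((m + b)%:R / m%:R)%:E - 1) * (m + b)%:R%:E)); last first.
  by apply: lee_wpmul2r; rewrite ?lee_fin ?ler0n// leeB.
rewrite -EFinB -EFinM lee_fin natrD.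
have -> : ((m%:R + b%:R) / m%:R - 1 = b%:R / m%:R :> R)%R.
  by field; rewrite gt_eqF.
by rewrite mulrAC -mulrA ler_peMr ?ler0n// ler_pdivlMr// mul1r lerDl ler0n.
Qed.

(** * The law of the number of occurrences *)

Section occupancy.
Context (d dA : measure_display) (Omega : measurableType d)
  (A : measurableType dA) (R : realType) (Pr : probability Omega R)
  (n : nat) (X : 'I_n -> {RV Pr >-> A}).

Definition hits (a : A) (w : Omega) : {set 'I_n} := [set i | X i w == a]%SET.

Lemma xi_card_hits a w : xi X a w = #|hits a w|.
Proof. by rewrite /xi /hits -sum1dep_card [RHS]big_mkcond. Qed.

(** This form exposes an intersection of events X_i in B_i over all indices,
    to which independence applies. *)
Lemma hits_eqE a (J : {set 'I_n}) :
  [set w | hits a w = J] =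
  \bigcap_(i in [set` [set: 'I_n]%SET])
    (X i @^-1` (if i \in J then [set a] else ~` [set a])).
Proof.
apply/seteqP; split => w /=.
  by move=> <- i _ /=; rewrite inE; case: eqP.
move=> h; apply/setP => i; rewrite inE.
have := h i; rewrite /= inE => /(_ isT).
by case: (i \in J) => /= /eqP // /negPf.
Qed.

Lemma measurable_hits_eq a (J : {set 'I_n}) :
  measurable [set a] -> measurable [set w | hits a w = J].
Proof.
move=> ma; rewrite hits_eqE; apply: fin_bigcap_measurable => // i _.
rewrite -[X in measurable X]setTI; apply: measurable_funP => //.
by case: ifP => // _; exact: measurableC.
Qed.

Lemma prob_hits_eq (p : A -> R) a (J : {set 'I_n}) :
  measurable [set a] -> iid_sample p X ->
  Pr [set w | hits a w = J] = (p a ^+ #|J| * (1 - p a) ^+ (n - #|J|))%:E.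
Proof.
move=> ma [ind law].
have law1 i : Pr (X i @^-1` [set a]) = (p a)%:E by rewrite -(law i a).
rewrite hits_eqE ind; last by move=> i; case: ifP => // _; exact: measurableC.
rewrite (eq_bigr (fun i => (if i \in J then p a else 1 - p a)%:E)); last first.
  move=> i _; case: ifP => [_|_]; first exact: law1.
  rewrite -[X in Pr X]preimage_setC probability_setC ?law1//.
  by rewrite -[X in measurable X]setTI; exact: measurable_funP.
rewrite prodEFin; congr _%:E; rewrite (bigID (mem J))/=.
rewrite (eq_bigr (fun=> p a)); last by move=> i /andP[_ ->].
rewrite [X in (_ * X)%R](eq_bigr (fun=> 1 - p a)%R); last first.
  by move=> i /andP[_ /negPf ->].
rewrite !prodr_const; congr (_ ^+ _ * _ ^+ _)%R.
  by apply: eq_card => i; rewrite unfold_in inE.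
have -> : (n - #|J| = #|~: J|)%N.
  by rewrite [RHS]cardsCs finset.setCK card_ord.
by apply: eq_card => i; rewrite unfold_in !inE.
Qed.

Lemma xi_eqE a r :
  [set w | xi X a w = r] =
  \bigcup_(J in [set J : {set 'I_n} | #|J| == r])
    [set w | hits a w = J].
Proof.
apply/seteqP; split => w /=; rewrite xi_card_hits.
  by move=> h; exists (hits a w) => //=; apply/eqP.
by move=> [J /= /eqP <- ->].
Qed.

Lemma measurable_xi_eq a r :
  measurable [set a] -> measurable [set w | xi X a w = r].
Proof.
move=> ma; rewrite xi_eqE; apply: fin_bigcup_measurable => // J _.
exact: measurable_hits_eq.
Qed.

Lemma xi_binomial (p : A -> R) a r :
  measurable [set a] -> iid_sample p X ->
  Pr [set w | xi X a w = r] =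
  ('C(n, r)%:R * (p a ^+ r * (1 - p a) ^+ (n - r)))%:E.
Proof.
move=> ma iidX; rewrite xi_eqE measure_fin_bigcup//; last 3 first.
- exact: finite_finset.
- by move=> J K _ _ [w [/= <- <-]].
- by move=> J _; exact: measurable_hits_eq.
rewrite -(bigfs _ (r := enum {set 'I_n}) (P := fun J => #|J| == r)) ?enum_uniq//; last first.
  by move=> J _; rewrite mem_enum.
rewrite (eq_bigr (fun=> (p a ^+ r * (1 - p a) ^+ (n - r))%:E)); last first.
  by move=> J /= /eqP <-; exact: prob_hits_eq.
rewrite sumEFin; congr _%:E.
rewrite big_enum_cond /= sumr_const mulr_natl; congr (_ *+ _)%R.
by rewrite -[n in RHS]card_ord -card_draws; by apply: eq_card => J; rewrite unfold_in !inE.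
Qed.

End occupancy.

(** * The two parts of the sum and the expectation *)

Lemma dyadic_window_integral (R : realType) (x k eps : R) :
  (0 <= x <= eps)%R -> (0 <= k)%R ->
  \int[lebesgue_measure]_(u in `]0%R, eps]) (k * \1_(`](x / 2)%R, x]) u)%:E =
  (k * (x / 2))%:E.
Proof.
move=> /andP[x0 xe] k0.
under eq_integral do rewrite EFinM.
rewrite ge0_integralZl_EFin//; last first.
  by apply/measurable_EFinP; exact: measurable_funTS.
rewrite integral_indic//.
have -> : `](x / 2)%R, x]%classic `&` `]0%R, eps]%classic =
  `](x / 2)%R, x]%classic.
  apply/seteqP; split => u /=; first by case.
  rewrite !in_itv/= => /andP[h1 h2]; split; first exact/andP.
  by apply/andP; split; lra.
rewrite EFinM; congr (_ * _).
apply: etrans (lebesgue_measure_itv _) _; rewrite /= lte_fin.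
case: ltP => h; first by rewrite -EFinB; congr _%:E; field.
have -> : x = 0%R by lra.
by rewrite mul0r.
Qed.

(** At a fixed u, the letters whose window ]p_a/2, p_a] contains u are those with
    u <= p_a < 2u, and for them p_a/2 <= u and 1 - p_a <= 1 - u/2, so that each
    term is at most the weight at u. *)
Lemma window_sum_le_integrand (R : realType) (A : choiceType) (p : A -> R)
    (n r : nat) (S : set A) (u : R) :
  is_pmf p -> (0 < u <= 1)%R ->
  \esum_(a in S)
    (((p a / 2) ^+ r * (1 - p a) ^+ (n - r)) * \1_(`](p a / 2)%R, p a]) u)%:E <=
  (kappa_plus p (2 * u) - 1) * nu p u * (u ^+ r * (1 - u / 2) ^+ (n - r))%:E.
Proof.
move=> pmf /andP[u0 u1]; have p01 := pmf.1.
set w := (u ^+ r * _)%R.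
have w0 : (0 <= w)%R.
  by rewrite mulr_ge0// exprn_ge0//; [exact: ltW | lra].
pose B := [set a | (u <= p a < 2 * u)%R].
have finB : finite_set B.
  by apply: sub_finite_set (finite_atoms_ge pmf u0) => a /= /andP[].
apply: (@le_trans _ _ (\esum_(a in B) w%:E)).
  rewrite esum_mkcond [X in _ <= X]esum_mkcond; apply: le_esum => a _.
  have /andP[pa0 pa1] := p01 a.
  case: (boolP (a \in B)) => aB; last first.
    case: ifP => // _; rewrite lee_fin indicE memNset ?mulr0//= in_itv/= => h.
    by move/negP: aB; apply; rewrite inE /B/=; move/andP: h => [h1 h2]; lra.
  case: ifP => _; rewrite lee_fin ?w0//.
  rewrite indicE; case: (_ \in _); last by rewrite mulr0.
  rewrite mulr1; move: aB; rewrite inE /B/= => /andP[h1 h2].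
  apply: ler_pM; rewrite ?exprn_ge0//; try lra.
    by rewrite lerXn2r// ?nnegrE; lra.
  by rewrite lerXn2r// ?nnegrE; lra.
rewrite esum_cst_counting// muleC; apply: lee_wpmul2r; first by rewrite lee_fin.
exact: counting_dyadic_le_kappa.
Qed.

Lemma small_atoms_le_theta (R : realType) (A : choiceType) (p : A -> R)
    (n r : nat) (eps : R) :
  countable [set: A] -> is_pmf p -> (0 < eps <= 1)%R ->
  \esum_(a in [set a | (p a < eps)%R])
    (p a * ('C(n, r)%:R * (p a ^+ r * (1 - p a) ^+ (n - r))))%:E <=
  theta_plus p n r eps.
Proof.
move=> cA pmf /andP[e0 e1]; have p01 := pmf.1.
pose k a := ((p a / 2) ^+ r * (1 - p a) ^+ (n - r))%R.
have k0 a : (0 <= k a)%R.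
  by have := p01 a; rewrite /k => pa; rewrite mulr_ge0// exprn_ge0//; lra.
set S := [set a | _].
apply: (@le_trans _ _ (((2 ^+ (1 + r) * 'C(n, r)%:R)%R)%:E *
    \esum_(a in S) (k a * (p a / 2))%:E)).
  apply: le_trans (esumZ_le _ _ _); last 2 first.
  - by rewrite mulr_ge0.
  - move=> a; rewrite lee_fin mulr_ge0//.
    by have := p01 a => pa; lra.
  apply: le_esum => a _; rewrite -EFinM lee_fin le_eqVlt; apply/orP; left.
  apply/eqP; rewrite /k expr_div_n exprD; field.
  by apply: expf_neq0; rewrite pnatr_eq0.
rewrite /theta_plus lee_wpmul2l// ?lee_fin ?mulr_ge0//.
(* The factor p_a/2 is the measure of the window of a. *)
under eq_esum => a aS.
  rewrite -(@dyadic_window_integral _ _ _ eps)//; last first.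
    by have := p01 a; move: aS; rewrite /S/= => ?; lra.
  over.
rewrite -integral_esum//; last 3 first.
- apply: sub_countable cA; exact: subset_card_le.
- move=> a _; apply/measurable_EFinP; exact: measurable_funM.
- by move=> a u _ _; rewrite lee_fin mulr_ge0.
apply: ge0_le_integral_nonmeasurable => u.
  by move=> _; apply: esum_ge0 => a _; rewrite lee_fin mulr_ge0.
rewrite /= in_itv/= => /andP[u0 ue].
by apply: window_sum_le_integrand => //; rewrite u0 (le_trans ue).
Qed.

Lemma large_atoms_le_phi (R : realType) (A : choiceType) (p : A -> R)
    (n r : nat) (eps : R) :
  is_pmf p -> (0 < eps)%R -> (1 <= n)%N -> (r <= n - 1)%N ->
  \esum_(a in [set a | (eps <= p a)%R])
    (p a * ('C(n, r)%:R * (p a ^+ r * (1 - p a) ^+ (n - r))))%:E <=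
  phi_plus p n r eps.
Proof.
move=> pmf e0 n1 rn; have p01 := pmf.1.
apply: (@le_trans _ _ (\esum_(a in [set a | (eps <= p a)%R])
    (c_const r / n%:R)%:E)).
  by apply: le_esum => a _; rewrite lee_fin; exact: expected_mass_le_c.
rewrite esum_cst_counting//; last 2 first.
- exact: finite_atoms_ge.
- rewrite divr_ge0// /c_const; case: ifP => _; first exact: expR_ge0.
  by rewrite divr_ge0 ?sqrtr_ge0// mulr_ge0 ?expR_ge0// addr_ge0.
by rewrite /phi_plus inver pnatr_eq0 gtn_eqF// EFinM muleAC.
Qed.

Lemma expected_M_le (R : realType) (d dA : measure_display)
    (Omega : measurableType d) (Pr : probability Omega R)
    (A : measurableType dA) (p : A -> R) (n r : nat)
    (X : 'I_n -> {RV Pr >-> A}) :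
  countable [set: A] -> (forall a : A, measurable [set a]) ->
  is_pmf p -> iid_sample p X ->
  'E_Pr[M p r X] <= \esum_(a in [set: A])
    (p a * ('C(n, r)%:R * (p a ^+ r * (1 - p a) ^+ (n - r))))%:E.
Proof.
move=> cA mA pmf iidX; have p0 a : (0 <= p a)%R by case/andP: (pmf.1 a).
pose f a w := (p a * \1_[set w | xi X a w = r] w)%:E.
have f0 a w : 0 <= f a w by rewrite lee_fin mulr_ge0.
have mf a : measurable_fun [set: Omega] (f a).
  apply/measurable_EFinP; apply: measurable_funM => //.
  by apply: measurable_indic; exact: measurable_xi_eq.
rewrite unlock.
apply: (@le_trans _ _ (\int[Pr]_w \esum_(a in [set: A]) f a w)).
  have -> : (fun w => (M p r X w)%:E) =
      (fun w => (fine (\esum_(a in [set: A]) f a w))%:E).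
    apply/funext => w; rewrite /M; congr (_%:E); congr fine.
    apply: eq_esum => a _; rewrite /f indicE; congr (_ * (nat_of_bool _)%:R)%:E.
    by apply/idP/idP => [/eqP h|/set_mem/= ->]; rewrite ?inE.
  apply: ge0_le_integral_nonmeasurable => w _.
    by rewrite lee_fin fine_ge0// esum_ge0.
  (* fine sends +oo to 0, so fine x <= x for every x >= 0. *)
  have : 0 <= \esum_(a in [set: A]) f a w by exact: esum_ge0.
  by case: (esum _ _) => //= _; rewrite leey.
rewrite integral_esum//; apply: le_esum => a _.
rewrite /f; under eq_integral do rewrite EFinM.
rewrite ge0_integralZl_EFin//; last first.
  apply/measurable_EFinP; apply: measurable_indic; exact: measurable_xi_eq.
rewrite integral_indic//; last exact: measurable_xi_eq.
have PE := xi_binomial r (mA a) iidX.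
by rewrite setIT [X in _ * X <= _]PE -EFinM.
Qed.

Unset Implicit Arguments.

Theorem theorem2p2 (R : realType) (d dA : measure_display)
  (Omega : measurableType d) (Pr : probability Omega R)
  (A : measurableType dA)
  (A_countable : countable [set: A])
  (A_discrete : forall B : set A, measurable B)
  (p : A -> R) (p_pmf : is_pmf p)
  (n r : nat) (n_ge1 : (1 <= n)%N) (r_le : (r <= n - 1)%N)
  (X : 'I_n -> {RV Pr >-> A}) (X_iid : iid_sample p X) :
  'E_Pr[M p r X] <=
  ereal_inf [set phi_plus p n r eps + theta_plus p n r eps
            | eps in `]0%R, (1 / 2)%R]].
Proof.
apply: le_ereal_inf_tmp => _ /= [eps + <-]; rewrite in_itv/= => /andP[e0 e1].
apply: le_trans (expected_M_le _ _ _ p_pmf X_iid) _ => //.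
have g0 a : 0 <= (p a * ('C(n, r)%:R * (p a ^+ r * (1 - p a) ^+ (n - r))))%:E.
  by have := p_pmf.1 a => pa; rewrite lee_fin !(mulr_ge0, exprn_ge0)//; lra.
rewrite (esumID [set a | (eps <= p a)%R])// !setTI; apply: leeD.
  exact: large_atoms_le_phi.
have -> : ~` [set a | (eps <= p a)%R] = [set a | (p a < eps)%R].
  by apply/seteqP; split => a /=; rewrite ltNge => /negP.
by apply: small_atoms_le_theta => //; rewrite e0/=; lra.
Qed.
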